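(* Let $G$ be an abelian group and let $R$ be a $G$-graded ring. If $f$ is a nonzero central idempotent in $R$, then $f$ has finite support group. In particular, the support of a nonzero central idempotent in $R$ is contained in the torsion subgroup of $G$.
   Context: Rings are associative but not necessarily unital and not necessarily commutative. Let $G$ be a group with identity element $e$. A ring $R$ is $G$-graded if there is a collection of additive subgroups $\{R_g\}_{g\in G}$ of $R$ such that $R=\bigoplus_{g\in G} R_g$ and $R_gR_h\subseteq R_{gh}$ for all $g,h\in G$. The support of a nonzero element $r=\sum_{g\in G} r_g$ (with $r_g\in R_g$) is the finite set $\operatorname{Supp}(r)=\{g\in G\mid r_g\neq 0\}$. The support group of $r$ is the subgroup of $G$ generated by $\operatorname{Supp}(r)$. *)

(* Defs.v *)
From HB Require Import structures.
From mathcomp Require Import all_boot all_algebra.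
From mathcomp Require Import boolp classical_sets functions cardinality fsbigop.

Set Implicit Arguments.
Unset Strict Implicit.
Unset Printing Implicit Defensive.

Import GRing.Theory.
Local Open Scope classical_set_scope.
Local Open Scope ring_scope.

(* Associative rings, neither unital nor commutative in general: an additive
   [zmodType] and a multiplicative [semigroupType] on the same carrier.  The
   ring product is therefore the [*] of [group_scope]. *)
HB.mixin Record Zmodule_Semigroup_isRng R
    of GRing.Zmodule R & Semigroup R := {
  rngMDl : @left_distributive R R *%g +%R;
  rngMDr : @right_distributive R R *%g +%R
}.

#[short(type="rngType")]
HB.structure Definition Rng :=
  {R of Zmodule_Semigroup_isRng R & GRing.Zmodule R & Semigroup R}.

(* [c] is a way of writing [r] as a finite sum of elements [c g] of [S g].
   The finiteness clause matters: [\sum_(g \in _)] is [0] by convention when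
   infinitely many terms are nonzero. *)
Definition is_decomposition (G : choiceType) (R : zmodType)
    (S : G -> set R) (r : R) (c : G -> R) : Prop :=
  [/\ forall g, S g (c g),
      finite_set [set g | c g != 0] &
      r = \sum_(g \in [set: G]) c g].

Record grading (G : groupType) (R : rngType) := Grading {
  homog : G -> set R;
  homog_zmod : forall g, zmod_closed (mem (homog g));
  homog_direct : forall r : R, exists! c : G -> R, is_decomposition homog r c;
  homogM : forall (g h : G) (x y : R),
    homog g x -> homog h y -> homog (g * h)%g (x * y)%g
}.

Section GradedRing.
Variables (G : groupType) (R : rngType) (A : grading G R).

Definition component (r : R) : G -> R := sval (cid (homog_direct A r)).

Definition Supp (r : R) : set G := [set g | component r g != 0].

Definition support_group (r : R) : set G :=
  smallest [set H : set G | group_closed (mem H)] (Supp r).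

End GradedRing.

Definition torsion (G : groupType) : set G :=
  [set g | exists2 n : nat, (0 < n)%N & (g ^+ n = 1)%g].

Arguments torsion : clear implicits.

Definition central (R : rngType) (x : R) : Prop := forall r : R, commute x r.

Definition idempotent_element (R : rngType) (x : R) : Prop := (x * x)%g = x.

(* Main.v *)
Require Import Defs.
From HB Require Import structures.
From mathcomp Require Import all_boot all_order all_algebra.
From mathcomp Require Import boolp classical_sets functions cardinality fsbigop.
From mathcomp Require Import zify.

Set Implicit Arguments.
Unset Strict Implicit.
Unset Printing Implicit Defensive.

Import Order.TTheory GRing.Theory Num.Theory.
Local Open Scope classical_set_scope.
Local Open Scope ring_scope.

(** Suppose first that there is an integer weight [u] on the grading group
    which is additive on the support of a central idempotent [f], with
    homogeneous components [f_g].  Then [f(t) = \sum_g f_g t^(u g)] is an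
    idempotent of the Laurent polynomials over [R], and such an idempotent
    should be constant.  In characteristic zero this is the usual remark about
    derivations: [f' = 2 f f'] forces [f f' = 0], hence [f' = 0].  To allow
    torsion in the additive group of [R], all Hasse derivatives at [t = 1] are
    used together: writing [t = 1 + s], the series [D(s) = \sum_k D_k s^k] with
    [D_k = \sum_g 'C(u g, k) f_g] is idempotent with constant term [f], and
    comparing coefficients inductively gives [D_k = 0] for [k > 0].  If
    [u g > 0], the component of degree [g] of [D_k] for [k = u g] is [f_g]
    itself, so [f_g = 0].  Negative exponents are avoided by
    multiplying [f(t)] by a large power [t^M]: the equation becomes
    [D(s)^2 = (1 + s)^M D(s)], with solution [D(s) = (1 + s)^M f]
    ([idempotent_series_rigid], [central_idempotent_weight_le0]).  Centrality
    enters through the commutation of [f] with the [D_k].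

    It remains to produce weights.  If [x] is an element of infinite order of
    an abelian group, a subgroup [K] maximal among those meeting [<x>]
    trivially has the property that every [h] satisfies [a h = b x] modulo [K]
    for some integers [a], [b] with [a] nonzero.  The ratio [b / a] is a
    homomorphism to the rationals which sends [x] to 1
    ([exists_rational_weight]); clearing
    denominators on a finite support makes it integral
    ([exists_integer_weight]).  Hence the support of [f] consists of torsion
    elements, and finitely many of them generate a finite subgroup
    ([finite_zmod_closed_torsion]). *)

(** * Weights on abelian groups *)

Section SubgroupOfZmodule.
Variables (V : zmodType) (K : set V).
Hypothesis KB : forall a b, K a -> K b -> K (a - b).

Lemma set_subgroup0 a : K a -> K 0.
Proof. by move=> Ka; rewrite -(subrr a); apply: KB. Qed.

Lemma set_subgroupN a : K a -> K (- a).
Proof.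
by move=> Ka; rewrite -sub0r; apply: KB => //; apply: set_subgroup0 Ka.
Qed.

Lemma set_subgroupD a b : K a -> K b -> K (a + b).
Proof. by move=> Ka Kb; rewrite -(opprK b); apply/KB/set_subgroupN. Qed.

Lemma set_subgroupMz a (z : int) : K a -> K (a *~ z).
Proof.
move=> Ka; have KMn n : K (a *+ n).
  elim: n => [|n IHn]; first by rewrite mulr0n; apply: set_subgroup0 Ka.
  by rewrite mulrS; apply: set_subgroupD.
case: z => n; first by rewrite -pmulrn.
by rewrite NegzE mulrNz -pmulrn; apply/set_subgroupN.
Qed.

End SubgroupOfZmodule.

(** A pair [(a, b)] provided for [h] says that [a h] is congruent to [b x]
    modulo [K] with [a] nonzero.  Maximality of [K] gives it: adding [h] to [K]
    must create an intersection with the multiples of [x]. *)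
Lemma exists_essential_complement (V : zmodType) (x : V) :
    (forall n, x *+ n = 0 -> n = 0%N) ->
  exists K : set V, [/\ forall a b, K a -> K b -> K (a - b),
    forall z : int, K (x *~ z) -> z = 0 &
    forall h, exists ab : int * int, ab.1 != 0 /\ K (h *~ ab.1 - x *~ ab.2)].
Proof.
move=> x_free.
pose P := [set K : set V | (forall a b, K a -> K b -> K (a - b)) /\
                           forall n, K (x *+ n) -> n = 0%N].
have [|K [[KB Kx] Kmax]] := @Zorn_bigcup V P.
  move=> F FP Ftot; split=> [a b [X FX Xa] [Y FY Yb]|n [X FX]]; last first.
    by have [_] := FP X FX; apply.
  have [XY|YX] := Ftot X Y FX FY.
    by exists Y => //; apply: (FP Y FY).1 => //; apply: XY.
  by exists X => //; apply: (FP X FX).1 => //; apply: YX.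
(* The condition [P] admits the empty set, which keeps the union of an empty
   chain in [P]; a maximal [K] is not empty since [0] alone satisfies [P]. *)
have K0 : K 0.
  apply: contrapT => K0; apply: (Kmax [set 0]).
    split; first by move=> a Ka; case: K0; apply: set_subgroup0 Ka.
    by move=> /(_ 0 erefl).
  by split=> [a b -> ->|n]; [rewrite /= subr0|exact: x_free].
exists K; split=> // [z Kxz|h].
  apply/eqP; rewrite -absz_eq0; apply/eqP/Kx.
  rewrite pmulrn abszE; case: (ger0P z) => _ //.
  by rewrite mulrNz; apply: set_subgroupN.
have [Kh|Kh] := pselect (K h).
  by exists (1, 0); split=> //=; rewrite mulr1z mulr0z subr0.
pose Kh' := [set k + h *~ i | k in K & i in [set: int]].
have : ~ P Kh'.
  apply: Kmax; split.
    by move=> k Kk; exists k => //; exists 0 => //; rewrite mulr0z addr0.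
  move=> /(_ h); apply: contra_not Kh; apply.
  by exists 0 => //; exists 1; rewrite ?mulr1z ?add0r.
rewrite /P /= => /not_andP[[]|].
  move=> _ _ [k Kk [i _ <-]] [l Kl [j _ <-]].
  exists (k - l); first exact: KB.
  by exists (i - j) => //; rewrite mulrzBr opprD addrACA.
move=> /existsNP[n /not_implyP[[k Kk [i _ kE]] n0]].
exists (i, n : int); split=> /=.
  apply: contra_not_neq n0 => i0; apply: Kx.
  by rewrite -kE i0 mulr0z addr0.
rewrite -pmulrn -kE opprD addrCA subrr addr0.
exact: set_subgroupN.
Qed.

(** Congruences [a h = b x] modulo [K] with [a] nonzero determine [b / a],
    because no nonzero multiple of [x] lies in [K]; additivity follows since
    congruences for [g] and [h] combine into one for [g + h]. *)
Lemma exists_rational_weight (V : zmodType) (x : V) :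
    (forall n, x *+ n = 0 -> n = 0%N) ->
  exists2 w : V -> rat, {morph w : g h / g + h} & w x = 1.
Proof.
move=> /exists_essential_complement[K [KB Kx Kess]].
have w_uniq h (a b a' b' : int) :
    K (h *~ a - x *~ b) -> K (h *~ a' - x *~ b') -> b * a' = b' * a.
  move=> Kab Kab'; apply/eqP; rewrite eq_sym -subr_eq0; apply/eqP/Kx.
  have -> : x *~ (b' * a - b * a') =
            (h *~ a - x *~ b) *~ a' - (h *~ a' - x *~ b') *~ a.
    by rewrite mulrzBr !mulrzBl -!mulrzA [a' * a]mulrC opprB [RHS]addrC subrKA.
  by apply: (KB); apply: set_subgroupMz.
have [q qP] := choice Kess.
exists (fun h => (q h).2%:~R / (q h).1%:~R); last first.
  have [q0 Kq] := qP x.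
  have Kx1 : K (x *~ 1 - x *~ 1).
    by rewrite subrr; apply: set_subgroup0 Kq.
  have := w_uniq _ _ _ _ _ Kq Kx1; rewrite mulr1 mul1r => ->.
  by rewrite divff // intr_eq0.
move=> g h; have [g0 Kg] := qP g; have [h0 Kh] := qP h.
have [gh0 Kgh] := qP (g + h).
set a := (q g).1 in g0 Kg *; set b := (q g).2 in Kg *.
set c := (q h).1 in h0 Kh *; set d := (q h).2 in Kh *.
have Kgh' : K ((g + h) *~ (a * c) - x *~ (b * c + d * a)).
  have -> : (g + h) *~ (a * c) - x *~ (b * c + d * a) =
            (g *~ a - x *~ b) *~ c + (h *~ c - x *~ d) *~ a.
    by rewrite !mulrzBl -!mulrzA mulrzDl mulrzDr opprD addrACA [c * a]mulrC.
  by apply: set_subgroupD => //; apply: set_subgroupMz.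
have E := w_uniq _ _ _ _ _ Kgh Kgh'.
rewrite addf_div ?intr_eq0 //; apply/eqP.
by rewrite eqr_div ?mulf_neq0 ?intr_eq0 // -!(intrM, intrD) E.
Qed.

(** In general no integral weight is additive on the whole group, which may be
    divisible; but on finitely many elements it suffices to clear
    denominators. *)
Lemma exists_integer_weight (V : zmodType) (x : V) (s : seq V) :
    (forall n, x *+ n = 0 -> n = 0%N) ->
  exists2 u : V -> int, {in s &, {morph u : g h / g + h}} & 0 < u x.
Proof.
move=> /exists_rational_weight[w wD wx].
pose N := \prod_(g <- s) denq (w g).
have numqi (z : int) : numq z%:~R = z by rewrite numq_int.
have wN g : g \in s -> exists z : int, w g * N%:~R = z%:~R.
  move=> gs; exists (numq (w g) * \prod_(h <- rem g s) denq (w h)).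
  rewrite /N (perm_big _ (perm_to_rem gs)) big_cons !intrM mulrA.
  by rewrite numqE.
exists (fun g => numq (w g * N%:~R)).
  move=> g h /wN[a wa] /wN[b wb].
  by rewrite wD mulrDl wa wb -intrD !numqi.
by rewrite wx mul1r numqi prodr_gt0.
Qed.

(** Adding one torsion generator [x] to a finite subgroup [H] gives [H + <x>],
    which is the image of a finite product. *)
Lemma finite_zmod_closed_torsion (V : zmodType) (s : seq V) :
    {in s, forall x, exists2 n, (0 < n)%N & x *+ n = 0} ->
  exists H : set V, [/\ finite_set H, H 0,
    forall a b, H a -> H b -> H (a - b) & [set` s] `<=` H].
Proof.
elim: s => [|x s IHs] tors.
  exists [set 0]; split=> //; first by move=> _ _ -> ->; rewrite /= subr0.
have [|H [Hfin H0 HB sH]] := IHs.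
  by move=> y ys; apply: tors; rewrite inE ys orbT.
have [|[//|n] _ xn] := tors x; first by rewrite inE eqxx.
pose C := [set x *+ i | i in [set: nat]].
have Cfin : finite_set C.
  apply: sub_finite_set (finite_image (fun i => x *+ i) (finite_II n.+1)).
  move=> _ [i _ <-].
  exists (i %% n.+1)%N; first by rewrite /= ltn_mod.
  by rewrite [in RHS](divn_eq i n.+1) mulrnDr mulnC mulrnA xn mul0rn add0r.
exists [set h + c | h in H & c in C]; split.
- exact: finite_image2.
- by exists 0 => //; exists 0; [exists 0%N|rewrite addr0].
- move=> _ _ [h Hh [_ [i _ <-] <-]] [k Hk [_ [j _ <-] <-]].
  exists (h - k); first exact: HB.
  (* As [x] has order dividing [n.+1], [- x] is [x *+ n]. *)
  exists (x *+ (i + j * n)); first by exists (i + j * n)%N.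
  rewrite opprD addrACA mulrnDr; congr (_ + (_ + _)).
  by apply/eqP; rewrite -subr_eq0 opprK -mulrnDr -mulnSr mulnC mulrnA xn mul0rn.
- move=> y /=; rewrite inE => /orP[/eqP ->|ys].
    by exists 0 => //; exists x; [exists 1%N|rewrite add0r].
  by exists y; [exact: sH|exists 0; [exists 0%N|rewrite addr0]].
Qed.

(** * Idempotent power series over a nonunital ring *)

Section RngTheory.
Variable R : rngType.
Implicit Types x y : R.

Lemma rng0M x : (0 * x)%g = 0.
Proof. by apply: (@addrI _ (0 * x)%g); rewrite -rngMDl !addr0. Qed.

Lemma rngM0 x : (x * 0)%g = 0.
Proof. by apply: (@addrI _ (x * 0)%g); rewrite -rngMDr !addr0. Qed.

Lemma rngM_suml I (s : seq I) (F : I -> R) y :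
  (((\sum_(i <- s) F i)%R) * y)%g = \sum_(i <- s) (F i * y)%g.
Proof.
apply: (big_morph (fun x => (x * y)%g)) => [a b|]; first exact: rngMDl.
exact: rng0M.
Qed.

Lemma rngM_sumr I (s : seq I) (F : I -> R) x :
  (x * (\sum_(i <- s) F i)%R)%g = \sum_(i <- s) (x * F i)%g.
Proof.
apply: (big_morph (fun y => (x * y)%g)) => [a b|]; first exact: rngMDr.
exact: rngM0.
Qed.

Lemma rngMnAl x y n : ((x *+ n)%R * y)%g = (x * y)%g *+ n.
Proof. by elim: n => [|n IHn]; rewrite ?mulr0n ?rng0M // !mulrS rngMDl IHn. Qed.

Lemma rngMnAr x y n : (x * (y *+ n)%R)%g = (x * y)%g *+ n.
Proof. by elim: n => [|n IHn]; rewrite ?mulr0n ?rngM0 // !mulrS rngMDr IHn. Qed.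

(** In terms of formal power series, if [D(s)^2 = b(s) D(s)] with [b(0) = 1]
    and [D(0) = f] a central idempotent, then [D(s) = b(s) f].  In degree [k],
    once the lower coefficients are known, the equation reads
    [f D_k + D_k f = D_k + b_k f]; multiplying by [f] gives [f D_k = b_k f],
    and substituting this back gives [D_k = b_k f]. *)
Lemma idempotent_series_rigid (f : R) (D : nat -> R) (b : nat -> nat) :
    central f -> idempotent_element f -> D 0%N = f -> b 0%N = 1%N ->
    (forall k, \sum_(i < k.+1) (D i * D (k - i)%N)%g =
               \sum_(i < k.+1) D i *+ b (k - i)%N) ->
  forall k, D k = f *+ b k.
Proof.
move=> fC ff D0 b0 DD k; elim/ltn_ind: k => -[_|k IHk].
  by rewrite D0 b0 mulr1n.
have split_sum (F : nat -> R) :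
    \sum_(i < k.+2) F i = \sum_(i < k) F i.+1 + (F 0%N + F k.+1).
  by rewrite big_ord_recl big_ord_recr /= addrCA.
have := DD k.+1.
rewrite (split_sum (fun i => (D i * D (k.+1 - i)%N)%g)).
rewrite (split_sum (fun i => D i *+ b (k.+1 - i)%N)).
rewrite subn0 subnn D0 b0 mulr1n.
have -> : \sum_(i < k) (D i.+1 * D (k.+1 - i.+1)%N)%g
        = \sum_(i < k) D i.+1 *+ b (k.+1 - i.+1)%N.
  apply: eq_bigr => i _; rewrite (IHk i.+1) ?ltnS //.
  rewrite IHk ?subSS ?ltnS ?leq_subr //.
  by rewrite rngMnAl rngMnAr ff -!mulrnA mulnC.
move/addrI; rewrite [RHS]addrC => E.
have fDf : (f * D k.+1)%g = f *+ b k.+1.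
  have /(congr1 (fun x => (f * x)%g)) := E.
  rewrite !rngMDr rngMnAr -(fC (D k.+1)) mulgA ff.
  by move/addrI.
by move: E; rewrite -(fC (D k.+1)) fDf => /addIr.
Qed.
End RngTheory.

(** * Weighted sums of homogeneous components *)

Lemma fsum_uniq_seq (T : choiceType) (V : nmodType) (s : seq T) (c : T -> V) :
    uniq s -> (forall g, g \notin s -> c g = 0) ->
  \sum_(g \in [set: T]) c g = \sum_(g <- s) c g.
Proof.
move=> us c0; rewrite (fsbigE s) //; last by move=> g _; apply: c0.
by apply: eq_bigl => g; rewrite in_setT.
Qed.

Section GradedRingTheory.
Variables (G : groupType) (R : rngType) (A : grading G R).
Implicit Types (x y : R) (g h : G) (psi : G -> nat).

Lemma homog0 g : homog A g 0.
Proof. by have [/set_mem] := homog_zmod A g. Qed.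

Lemma homogB g x y : homog A g x -> homog A g y -> homog A g (x - y).
Proof.
by have [_ HB] := homog_zmod A g => Hx Hy; apply/set_mem/HB; apply: mem_set.
Qed.

Lemma homogD g x y : homog A g x -> homog A g y -> homog A g (x + y).
Proof. exact: (set_subgroupD (@homogB g)). Qed.

Lemma homogMn g x n : homog A g x -> homog A g (x *+ n).
Proof. by rewrite pmulrn; apply: (set_subgroupMz (@homogB g)). Qed.

Lemma component_decomposition x : is_decomposition (homog A) x (component A x).
Proof. by rewrite /component; case: cid => c []. Qed.

Lemma component_unique x c :
  is_decomposition (homog A) x c -> component A x = c.
Proof. by rewrite /component; case: cid => d /= [_]; apply. Qed.

Lemma component_homog x g : homog A g (component A x g).
Proof. by have [] := component_decomposition x. Qed.

Lemma Supp_seq x : exists2 s : seq G, uniq s & Supp A x = [set` s].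
Proof.
have [_ /finite_seqP[s sE] _] := component_decomposition x.
exists (undup s); first exact: undup_uniq.
by rewrite /Supp sE; apply/seteqP; split=> g /=; rewrite mem_undup.
Qed.

Lemma component_notin x (s : seq G) :
  Supp A x `<=` [set` s] -> forall g, g \notin s -> component A x g = 0.
Proof. by move=> xs g; apply: contraNeq => xg; apply: xs. Qed.

Lemma sum_component x (s : seq G) : uniq s -> Supp A x `<=` [set` s] ->
  x = \sum_(g <- s) component A x g.
Proof.
move=> us /component_notin xs; have [_ _ {1}->] := component_decomposition x.
exact: fsum_uniq_seq.
Qed.

Lemma component_unique_seq x (s : seq G) c :
    uniq s -> (forall g, homog A g (c g)) ->
    (forall g, g \notin s -> c g = 0) -> x = \sum_(g <- s) c g ->
  component A x = c.
Proof.
move=> us cA c0 xE; apply: component_unique; split=> //.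
  apply: (@sub_finite_set _ _ [set` s]); last by apply/finite_seqP; exists s.
  by move=> g /=; apply: contraNT => /c0 ->.
by rewrite (fsum_uniq_seq us).
Qed.

(** When [psi g = 'C(u g, k)], this is the [k]-th Hasse derivative at [t = 1]
    of [\sum_g component A x g t^(u g)]. *)
Definition twist psi x : R := \sum_(g \in [set: G]) component A x g *+ psi g.

Lemma twistE psi x (s : seq G) : uniq s -> Supp A x `<=` [set` s] ->
  twist psi x = \sum_(g <- s) component A x g *+ psi g.
Proof.
move=> us /component_notin xs; apply: fsum_uniq_seq => // g /xs ->.
exact: mul0rn.
Qed.

Lemma component_twist psi x g :
  component A (twist psi x) g = component A x g *+ psi g.
Proof.
have [s us xs] := Supp_seq x; have {}xs : Supp A x `<=` [set` s] by rewrite xs.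
rewrite (component_unique_seq (c := fun h => component A x h *+ psi h) us) //.
- by move=> h; apply/homogMn/component_homog.
- by move=> h /(component_notin xs) ->; rewrite mul0rn.
- exact: twistE.
Qed.

(** [twist psi] is additive, but [component A] is only characterized by
    uniqueness; both are compared on a list containing the supports of [x] and
    [y]. *)
Lemma twistD psi : {morph twist psi : x y / x + y}.
Proof.
move=> x y; have [s us xs] := Supp_seq x; have [t ut yt] := Supp_seq y.
pose r := undup (s ++ t); have ur : uniq r := undup_uniq _.
have {us}xr : Supp A x `<=` [set` r].
  by rewrite xs => g /= gs; rewrite mem_undup mem_cat gs.
have {ut}yr : Supp A y `<=` [set` r].
  by rewrite yt => g /= gt; rewrite mem_undup mem_cat gt orbT.
have cD : component A (x + y) = (fun g => component A x g + component A y g).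
  apply: (component_unique_seq ur).
  - by move=> g; apply: homogD; apply: component_homog.
  - by move=> g gr; rewrite !(component_notin _ gr) ?addr0.
  - by rewrite big_split -!sum_component.
have xyr : Supp A (x + y) `<=` [set` r].
  move=> g; rewrite /Supp /= cD; apply: contraNT => gr.
  by rewrite !(component_notin _ gr) ?addr0.
rewrite !(@twistE _ _ r) // -big_split /=.
by apply: eq_bigr => g _; rewrite cD mulrnDl.
Qed.

Lemma twist_sum psi I (s : seq I) (F : I -> R) :
  twist psi (\sum_(i <- s) F i) = \sum_(i <- s) twist psi (F i).
Proof.
apply: (big_morph (twist psi)); first exact: twistD.
by apply: (@addrI _ (twist psi 0)); rewrite -twistD !addr0.
Qed.

Lemma twist_const n x : twist (fun=> n) x = x *+ n.
Proof.
have [s us xs] := Supp_seq x; have {}xs : Supp A x `<=` [set` s] by rewrite xs.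
by rewrite (twistE _ us xs) sumrMnl -sum_component.
Qed.

Lemma twist_homog psi g x : homog A g x -> twist psi x = x *+ psi g.
Proof.
move=> xg; pose c h := if h == g then x else 0.
have cE : component A x = c.
  apply: (@component_unique_seq _ [:: g]); rewrite /c ?big_seq1 ?eqxx //.
  - by move=> h; case: eqP => [->|_] //; apply: homog0.
  - by move=> h; rewrite inE => /negPf ->.
rewrite (@twistE _ _ [:: g]) ?big_seq1 ?cE /c ?eqxx // /Supp cE /c => h /=.
by rewrite inE; case: (h == g) => //; rewrite eqxx.
Qed.

(** A coproduct formula for [psi] yields a product formula for [twist psi];
    for binomial coefficients this turns the Vandermonde identity into the
    Leibniz rule for Hasse derivatives. *)
Lemma twistM psi n (phi chi : nat -> G -> nat) x y :
    (forall g h, Supp A x g -> Supp A y h ->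
      psi (g * h)%g = (\sum_(i < n) phi i g * chi i h)%N) ->
  twist psi (x * y)%g = \sum_(i < n) (twist (phi i) x * twist (chi i) y)%g.
Proof.
have [s us xs] := Supp_seq x; have [t ut yt] := Supp_seq y => psiM.
have xsE : Supp A x `<=` [set` s] by rewrite xs.
have ytE : Supp A y `<=` [set` t] by rewrite yt.
transitivity (\sum_(g <- s) \sum_(h <- t)
    (component A x g * component A y h)%g *+ psi (g * h)%g).
  rewrite {1}(sum_component us xsE) rngM_suml twist_sum.
  apply: eq_bigr => g _; rewrite {1}(sum_component ut ytE) rngM_sumr twist_sum.
  apply: eq_bigr => h _; apply: twist_homog.
  by apply: homogM; apply: component_homog.
transitivity (\sum_(i < n) \sum_(g <- s) \sum_(h <- t)
    ((component A x g *+ phi i g)%R *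
     (component A y h *+ chi i h)%R)%g); last first.
  apply: eq_bigr => i _; rewrite (twistE _ us xsE) (twistE _ ut ytE) rngM_suml.
  by apply: eq_bigr => g _; rewrite rngM_sumr.
rewrite [RHS]exchange_big /=; apply: eq_big_seq => g gs.
rewrite [RHS]exchange_big /=; apply: eq_big_seq => h ht.
rewrite psiM ?xs ?yt // -sumrMnr; apply: eq_bigr => i _.
by rewrite rngMnAl rngMnAr -mulrnA mulnC.
Qed.

(** The Laurent polynomial [\sum_g f_g t^(u g)] is idempotent, so the rigidity
    of idempotent series applies to its expansion at [t = 1]; the coefficient
    of [s^(u g)] isolates [f_g] when [u g] is positive. *)
Lemma central_idempotent_weight_le0 (f : R) (u : G -> int) :
    central f -> idempotent_element f ->
    (forall g h, Supp A f g -> Supp A f h -> u (g * h)%g = u g + u h) ->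
  forall g, Supp A f g -> u g <= 0.
Proof.
move=> fC ff uD g fg; have [s us fs] := Supp_seq f.
have fsE : Supp A f `<=` [set` s] by rewrite fs.
(* Multiplying by [t^M] makes all exponents nonnegative on the support. *)
pose M := (\sum_(h <- s) `|u h|)%N.
have uM h : Supp A f h -> 0 <= u h + M%:Z.
  rewrite fs => hs; suff : (`|u h| <= M)%N by lia.
  by rewrite /M (big_rem h) //= leq_addr.
(* [psi a k h] is the coefficient of [s^k] in [(1 + s)^(u h + a M)], and
   [D k] that of [s^k] in [t^M f(t)].  The product [(t^M f(t))^2] involves
   [a = 2]; by idempotence it is also [t^M (t^M f(t))]. *)
pose psi a k h := 'C(absz (u h + (a * M)%N%:Z), k).
pose D k := twist (psi 1%N k) f.
have D0 : D 0%N = f.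
  rewrite /D (twistE _ us fsE) [RHS](sum_component us fsE).
  by apply: eq_bigr => h _; rewrite /psi bin0.
have psi2 k h : Supp A f h ->
    psi 2 k h = (\sum_(i < k.+1) psi 1%N i h * 'C(M, k - i))%N.
  move=> /uM hM; rewrite binomial.Vandermonde /psi; congr 'C(_, _).
  lia.
have psi2M k g1 g2 : Supp A f g1 -> Supp A f g2 ->
    psi 2 k (g1 * g2)%g =
    (\sum_(i < k.+1) psi 1%N i g1 * psi 1%N (k - i)%N g2)%N.
  move=> f1 f2; have := uM _ f1; have := uM _ f2.
  rewrite binomial.Vandermonde /psi uD // => ? ?; congr 'C(_, _).
  lia.
have DE := idempotent_series_rigid fC ff D0 (bin0 M) _.
have {}DE k : D k = f *+ 'C(M, k).
  apply: DE => {}k.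
  transitivity (twist (psi 2 k) f).
    rewrite -[in RHS]ff.
    rewrite (@twistM _ k.+1 (psi 1%N) (fun i => psi 1%N (k - i)%N)) // => *.
    exact: psi2M.
  rewrite (twistE _ us fsE).
  under [RHS]eq_bigr => i _ do rewrite /D (twistE _ us fsE) -sumrMnl.
  rewrite [RHS]exchange_big /=; apply: eq_big_seq => h hs.
  rewrite psi2 ?fs // -sumrMnr; apply: eq_bigr => i _.
  by rewrite mulrnA.
rewrite leNgt; apply/negP => ug; move: (fg); rewrite /Supp /=.
(* In degree [g], the [m]-th coefficient is ['C(m, m) f_g] on one side and
   ['C(M, m) f_g = 0] on the other. *)
pose m := absz (u g + M%:Z).
have Mm : (M < m)%N by rewrite /m; lia.
have := congr1 (fun x => component A x g) (DE m).
rewrite -twist_const !component_twist /psi mul1n binn mulr1n.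
by rewrite bin_small // mulr0n => ->; rewrite eqxx.
Qed.
End GradedRingTheory.

(** * Central idempotents have finite support group *)

Theorem theorem1 (G : groupType) (abelG : forall x y : G, (x * y = y * x)%g)
    (R : rngType) (A : grading G R) (f : R) (f_neq0 : f <> 0)
    (f_central : central f) (f_idem : idempotent_element f) :
  finite_set (support_group A f) /\ Supp A f `<=` torsion G.
Proof.
(* Additive notation for [G] gives access to the integer multiples [*~]. *)
pose isZ := GRing.isZmodule.Build G (@mulgA G) abelG (@mul1g G) (@mulVg G).
pose V : zmodType := HB.pack (G : Type) (Choice.on G) isZ.
have [s _ fs] := Supp_seq A f.
have expE (x : V) n : x *+ n = ((x : G) ^+ n)%g.
  by elim: n => [|n IHn] //; rewrite mulrS expgS IHn.
have suppT : Supp A f `<=` torsion G.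
  move=> g fg; apply: contrapT => gT.
  have [|u uD] := @exists_integer_weight V g s.
    move=> n; rewrite expE => gn; apply/eqP; rewrite -leqn0 leqNgt.
    by apply/negP => n0; apply: gT; exists n.
  rewrite ltNge => /negP; apply.
  apply: (central_idempotent_weight_le0 f_central f_idem) fg => g1 g2.
  by rewrite fs; apply: uD.
split=> //.
have [|H [Hfin H1 HB sH]] := @finite_zmod_closed_torsion V s.
  move=> g gs; have [|n n0 gn] := suppT g; first by rewrite fs.
  by exists n => //; rewrite expE.
apply: sub_finite_set Hfin; apply: smallest_sub; last by rewrite fs.
by split=> [|a b]; rewrite !inE //; apply: HB.
Qed.
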